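(* Let $T$ be a semistandard skew tableau of shape $\lambda/\mu$, let $u$ be an internal insertion order word of $T$, and let $v$ be a word Knuth equivalent to $u$. Then (a) $v$ is an internal insertion order word of $T$; (b) $\phi_u T=\phi_v T$.
   Context: Partitions are identified with Young diagrams in English convention; cell $(i,j)$ is in row $i$, column $j$. For partitions $\mu\subseteq\lambda$, a semistandard skew tableau of shape $\lambda/\mu$ is a filling of the cells of $\lambda\setminus\mu$ with positive integers weakly increasing along rows and strictly increasing down columns. A skew tableau $U$ of shape $\beta/\mu$ is standard if its entries are $1,\dots,|\beta|-|\mu|$, each once. The standardisation $\mathrm{std}\,U$ of a semistandard $U$ renumbers its entries $1,\dots,|U|$ in numerical order, equal entries being ordered left to right. The companion word of $U$ is $R(U)=u_{|U|}\cdots u_2u_1$, where $u_p=i$ if the number $p$ lies in row $i$ of $\mathrm{std}\,U$. An inner corner of $T$ (shape $\lambda/\mu$) is a cell $(i,j)\in\lambda/\mu$ with $(i-1,j),(i,j-1)\notin\lambda/\mu$; an empty cell $(i,\mu_i+1)$ is also allowed as an inner corner provided $(i-1,\mu_i+1),(i,\mu_i)\notin\lambda/\mu$. The internal row insertion operator $\phi_i$ is defined on $T$ when $(i,\mu_i+1)$ is an inner corner: if the cell is filled, its entry is removed (the cell joins the inner shape) and is Schensted row-inserted into row $i+1$, the bumped entry into row $i+2$, etc., until an entry settles at the end of some row (adding one box to the outer shape); if the cell is empty, $\phi_i$ just adjoins it to the inner shape. For a word $w=w_m\cdots w_2w_1$, $\phi_w:=\phi_{w_m}\circ\cdots\circ\phi_{w_1}$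 (so $w_1$ acts first), $\phi_\emptyset=\mathrm{id}$. An internal insertion order word of $T$ is the companion word $R(U)$ of some skew tableau $U$ of shape $\beta/\mu$ for some partition $\beta\supseteq\mu$ (same inner shape as $T$); for such a word $u$, $\phi_uT$ is defined (this is the $P$-tableau of the Sagan–Stanley internal insertion correspondence). Knuth equivalence of words is the equivalence generated by $xzy\equiv zxy$ for $x\le y<z$ and $yxz\equiv yzx$ for $x<y\le z$ (applied to consecutive letters). *)

(* Defs.v *)
From Stdlib Require Import Relation_Operators.
From mathcomp Require Import all_boot.

Set Implicit Arguments.
Unset Strict Implicit.
Unset Printing Implicit Defensive.

(** Rows, columns and the letters of words of row indices are numbered from 0:
    [i : nat] stands for row [i + 1]. *)

Definition is_part (p : seq nat) : bool := sorted geq p && (0 \notin p).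

(** [rows T] lists the entries of each row of the outer shape from left to
    right; rows without a cell of the skew shape are listed as [[::]]. Row [i]
    occupies the columns [inner i, ..., inner i + size (row i) - 1]. *)
Record skewtab := SkewTab { inner : seq nat; rows : seq (seq nat) }.

Section Shape.
Variable T : skewtab.

Definition row (i : nat) : seq nat := nth [::] (rows T) i.

Definition mu (i : nat) : nat := nth 0 (inner T) i.

Definition outer : seq nat :=
  mkseq (fun i => mu i + size (row i)) (size (rows T)).

Definition in_shape (i j : nat) : bool := mu i <= j < nth 0 outer i.

Definition entry (i j : nat) : nat := nth 0 (row i) (j - mu i).

Definition cells : seq (nat * nat) :=
  [seq (i, j) | i <- iota 0 (size (rows T)), j <- iota (mu i) (size (row i))].

End Shape.

(** Since [outer T] has no zero part, [rows T] has exactly one item per row of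
    the outer shape, so a semistandard skew tableau together with its shape is
    represented by exactly one [T]. *)
Record semistandard (T : skewtab) : Prop := Semistandard {
  inner_part : is_part (inner T);
  outer_part : is_part (outer T);
  inner_sub_outer : size (inner T) <= size (rows T);
  entry_pos : forall i j, in_shape T i j -> 0 < entry T i j;
  row_weak : forall i j, in_shape T i j -> in_shape T i j.+1 ->
    entry T i j <= entry T i j.+1;
  col_strict : forall i j, in_shape T i j -> in_shape T i.+1 j ->
    entry T i j < entry T i.+1 j
}.

(** Equal entries of a semistandard tableau lie in distinct columns. *)
Definition std_before (U : skewtab) (c d : nat * nat) : bool :=
  let x := entry U c.1 c.2 in let y := entry U d.1 d.2 in
  (x < y) || (x == y) && (c.2 < d.2).

Definition std_entry (U : skewtab) (i j : nat) : nat :=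
  (count (fun c => std_before U c (i, j)) (cells U)).+1.

Definition std (U : skewtab) : skewtab :=
  SkewTab (inner U)
    (mkseq (fun i => [seq std_entry U i j | j <- iota (mu U i) (size (row U i))])
           (size (rows U))).

Definition row_of (S : skewtab) (p : nat) : nat :=
  find (fun r => p \in r) (rows S).

Definition companion (U : skewtab) : seq nat :=
  rev [seq row_of (std U) p | p <- iota 1 (size (cells U))].

Definition insertion_order_word (T : skewtab) (u : seq nat) : Prop :=
  exists U : skewtab,
    [/\ semistandard U, inner U = inner T & companion U = u].

(** For an empty cell this does not by itself force the enlarged inner shape to
    be a partition; for insertion order words it always is one, since the inner
    shape then runs through the partitions of a standard filling of beta/mu. *)
Definition inner_corner (T : skewtab) (i j : nat) : bool :=
  [&& in_shape T i j || (j == mu T i),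
      (if i is i'.+1 then ~~ in_shape T i' j else true)
    & (if j is j'.+1 then ~~ in_shape T i j' else true)].

Fixpoint insert_rows (rs : seq (seq nat)) (x : nat) : seq (seq nat) :=
  if rs is r :: rs' then
    let k := find (fun y => x < y) r in
    if k < size r then set_nth 0 r k x :: insert_rows rs' (nth 0 r k)
    else rcons r x :: rs'
  else [:: [:: x]].

(** When row [i] has no cell in the skew shape, the box is adjoined to the inner
    shape and hence also to the outer one: [set_nth] leaves the rows unchanged,
    or appends an empty row if [i] lies just below the outer shape. *)
Definition phi (i : nat) (T : skewtab) : option skewtab :=
  if inner_corner T i (mu T i) then
    let inner' := incr_nth (inner T) i in
    Some (if row T i is x :: r then
            SkewTab inner'
              (take i (rows T) ++ r :: insert_rows (drop i.+1 (rows T)) x)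
          else SkewTab inner' (set_nth [::] (rows T) i [::]))
  else None.

(** A word [w_m ... w_1] is the sequence [[:: w_m; ...; w_1]]; [w_1] acts first. *)
Definition phi_word (w : seq nat) (T : skewtab) : option skewtab :=
  foldr (fun i oT => obind (phi i) oT) (Some T) w.

Inductive knuth_step : seq nat -> seq nat -> Prop :=
| KnuthXZY a b x y z : x <= y < z ->
    knuth_step (a ++ [:: x; z; y] ++ b) (a ++ [:: z; x; y] ++ b)
| KnuthYXZ a b x y z : x < y <= z ->
    knuth_step (a ++ [:: y; x; z] ++ b) (a ++ [:: y; z; x] ++ b).

Definition knuth_equiv : seq nat -> seq nat -> Prop :=
  clos_refl_sym_trans (seq nat) knuth_step.

(* Main.v *)
From Stdlib Require Import Lia.
Require Import Defs.
From mathcomp Require Import all_boot zify_ssreflect.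

Set Implicit Arguments.
Unset Strict Implicit.
Unset Printing Implicit Defensive.

(** Fill the cells of the inner shape with zeros. As all entries are positive,
    [phi i] becomes Schensted insertion of a letter 0 that starts in row [i]:
    this 0 settles right after the zeros of row [i] and bumps the first entry of
    the skew row, if any.  Following the three letters of a Knuth relation row by
    row, the letters they bump out of a row either satisfy again one of the two
    Knuth relations or arrive in the same order in both words, so both words
    give the same filling.

    The insertion order words of a tableau with inner shape [mu] are the words
    all of whose suffixes, read as boxes added to [mu], give a partition: a
    companion word has this property because the cells with the smallest
    standardised entries form a shape above [mu], and the converse is the usual
    construction of a standard tableau from a Yamanouchi word.  Such words are
    stable under Knuth relations. *)

(** * Schensted insertion and Knuth relations *)

Fixpoint row_insert (r : seq nat) (x : nat) : seq nat * option nat :=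
  if r is y :: r' then
    if x < y then (x :: r', Some y)
    else (y :: (row_insert r' x).1, (row_insert r' x).2)
  else ([:: x], None).

Definition insert_opt (rs : seq (seq nat)) (o : option nat) : seq (seq nat) :=
  oapp (insert_rows rs) rs o.

Lemma insert_rows_cons r rs x :
  insert_rows (r :: rs) x =
  (row_insert r x).1 :: insert_opt rs (row_insert r x).2.
Proof.
rewrite /=; elim: r => [|y r IH] //=.
case xy: (x < y) => //=.
by move: IH; rewrite ltnS; case: ifP => _ [<- <-].
Qed.

Lemma row_insert_path m r x : m <= x -> path leq m r ->
  path leq m (row_insert r x).1.
Proof.
elim: r m => [|y r IH] m mx /=; first by rewrite mx.
case/andP=> my yr; case: ltnP => xy /=; last by rewrite my IH.
by rewrite mx; apply: path_le yr; [exact: leq_trans | exact: ltnW].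
Qed.

Lemma row_insert_sorted r x : sorted leq r -> sorted leq (row_insert r x).1.
Proof.
case: r => [|y r] //= yr; case: ltnP => xy /=; last exact: row_insert_path.
by apply: path_le yr; [exact: leq_trans | exact: ltnW].
Qed.

Lemma insert_rows_sorted rs x :
  all (sorted leq) rs -> all (sorted leq) (insert_rows rs x).
Proof.
elim: rs x => [|r rs IH] x // /andP[sr srs].
rewrite insert_rows_cons /= row_insert_sorted //=.
by case: (row_insert r x).2 => [y|] //=; apply: IH.
Qed.

Lemma bumped_gt r x y : (row_insert r x).2 = Some y -> x < y.
Proof. by elim: r => [|z r IH] //=; case: ltnP => // xz [<-]. Qed.

Lemma bumped_ge m r x y :
  path leq m r -> (row_insert r x).2 = Some y -> m <= y.
Proof.
elim: r m => [|z r IH] m //= /andP[mz zr]; case: ltnP => _ /=.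
  by case=> <-.
by move/(IH _ zr); apply: leq_trans.
Qed.

Lemma row_insert_weak_None r a c : a <= c -> (row_insert r a).2 = None ->
  (row_insert (row_insert r a).1 c).2 = None.
Proof.
move=> ac; elim: r => [|y r IH] /=; first by rewrite ltnNge ac.
by case: ltnP => //= ya /IH e; rewrite ltnNge (leq_trans ya ac).
Qed.

(** [c] passes the place taken by [a], and all that follows it in the sorted row is at least the
    letter bumped by [a]. *)
Lemma row_insert_weak r a c x y : sorted leq r -> a <= c ->
  (row_insert r a).2 = Some x -> (row_insert (row_insert r a).1 c).2 = Some y ->
  x <= y.
Proof.
move=> sr ac; elim: r sr => [|z r IH] //= zr; case: ltnP => za /=.
  by case=> <-; rewrite ltnNge ac /=; apply: bumped_ge.
by rewrite ltnNge (leq_trans za ac) /=; apply: IH; apply: path_sorted zr.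
Qed.

(** Now [b] stands in the row and exceeds [c], so [c] stops there or earlier, and [b] passed all
    earlier entries. *)
Lemma row_insert_strict r b c : c < b ->
  exists2 y, (row_insert (row_insert r b).1 c).2 = Some y & y <= b.
Proof.
move=> cb; elim: r => [|z r IH] /=; first by rewrite cb; exists b.
case: ltnP => bz /=; first by rewrite cb; exists b.
by case: ltnP => cz /=; first by exists z.
Qed.

Definition knuth_yxz rs := forall a b c, b < a <= c ->
  insert_rows (insert_rows (insert_rows rs a) b) c =
  insert_rows (insert_rows (insert_rows rs a) c) b.

Definition knuth_xzy rs := forall a b c, a <= c < b ->
  insert_rows (insert_rows (insert_rows rs a) b) c =
  insert_rows (insert_rows (insert_rows rs b) a) c.

(** Both orders leave the same row. Three bumped letters satisfy the relation again in the rows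
    below; fewer leave in the same order. *)
Lemma knuth_yxz_row r rs : sorted leq r -> knuth_yxz rs -> knuth_yxz (r :: rs).
Proof.
move=> sr K a b c /andP[ba ac]; rewrite !insert_rows_cons.
have ca : (c < a) = false by rewrite ltnNge ac.
have cb : (c < b) = false by lia.
suff [-> ->] :
  let r1 := row_insert r a in
  let rA := row_insert r1.1 b in let rAA := row_insert rA.1 c in
  let rB := row_insert r1.1 c in let rBB := row_insert rB.1 b in
  rAA.1 = rBB.1 /\
  insert_opt (insert_opt (insert_opt rs r1.2) rA.2) rAA.2 =
  insert_opt (insert_opt (insert_opt rs r1.2) rB.2) rBB.2 by [].
elim: r sr => [|y r IH] /=; first by rewrite ba ca /= cb ba.
move=> yr; case: ltnP => ay /=.
  (* The bumped letters are [y, a, d] against [y, d, a], with [a < y <= d]. *)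
  rewrite ba ca /= ba cb /=; split=> //.
  case E: (row_insert r c).2 => [d|] //=; apply: K.
  by rewrite ay (bumped_ge yr E).
have cy : (c < y) = false by lia.
rewrite cy /=; case: ltnP => lby /=; last first.
  rewrite cy /=; have [-> e] := IH (path_sorted yr); split=> //.
(* Only [b] stops at [y]: the bumped letters are [d, y, d'] against [d, d', y], with
   [y < d <= d']. *)
rewrite cb; split=> //=.
case E: (row_insert r a).2 => [d|] /=; last first.
  by rewrite (row_insert_weak_None ac E).
case F: (row_insert _ c).2 => [d'|] //=; apply: K.
rewrite (leq_ltn_trans ay (bumped_gt E)) /=.
exact: row_insert_weak (path_sorted yr) ac E F.
Qed.

Lemma insert_knuth_yxz rs : all (sorted leq) rs -> knuth_yxz rs.
Proof.
have K0 : knuth_yxz [::].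
  move=> a b c /andP[ba ac] /=.
  have -> : (c < a) = false by lia.
  have cb : (c < b) = false by lia.
  by rewrite ba /= cb ba.
by elim: rs => [|r rs IH] //= /andP[sr /IH]; apply: knuth_yxz_row.
Qed.

Lemma knuth_xzy_row r rs : sorted leq r -> all (sorted leq) rs ->
  knuth_xzy rs -> knuth_xzy (r :: rs).
Proof.
move=> sr srs K a b c /andP[ac cb]; rewrite !insert_rows_cons.
have ca : (c < a) = false by rewrite ltnNge ac.
have ba : (b < a) = false by lia.
have ab : a < b by lia.
suff [-> ->] :
  let rA := row_insert r a in
  let rAA := row_insert rA.1 b in let rAAA := row_insert rAA.1 c in
  let rB := row_insert r b in
  let rBB := row_insert rB.1 a in let rBBB := row_insert rBB.1 c in
  rAAA.1 = rBBB.1 /\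
  insert_opt (insert_opt (insert_opt rs rA.2) rAA.2) rAAA.2 =
  insert_opt (insert_opt (insert_opt rs rB.2) rBB.2) rBBB.2 by [].
elim: r sr => [|y r IH] /=; first by rewrite ba /= ca cb ab /= ca.
move=> yr; case: ltnP => ay /=; last first.
  have -> : (b < y) = false by lia.
  have ya : (a < y) = false by lia.
  have cy : (c < y) = false by lia.
  by rewrite /= ya /= cy /=; have [-> e] := IH (path_sorted yr).
rewrite ba /= ca /=; case: (ltnP b y) => lby /=.
  rewrite ab /= ca /=.
  case: r yr {IH} => [|z r] /=; first by rewrite cb.
  case/andP=> yz zr; have bz : b < z by lia.
  have -> : c < z by lia.
  rewrite bz /= cb; split=> //=.
  (* The bumped letters are [y, z, b] against [y, b, z] with [b < y <= z], which is the other Knuth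
     relation. *)
  by symmetry; apply: insert_knuth_yxz => //; rewrite lby.
(* The bumped letters are [y, d, e] against [d, y, e], with [y <= e <= b < d]. *)
rewrite ay /= ca; split=> //=.
case E: (row_insert r b).2 => [d|] //=.
have [e F leb] := row_insert_strict r cb.
rewrite F /=; apply: K.
rewrite (leq_ltn_trans leb (bumped_gt E)) andbT.
exact: bumped_ge (row_insert_path lby yr) F.
Qed.

Lemma insert_knuth_xzy rs : all (sorted leq) rs -> knuth_xzy rs.
Proof.
have K0 : knuth_xzy [::].
  move=> a b c /andP[ac cb] /=.
  have -> : (b < a) = false by lia.
  have ab : a < b by lia.
  have ca : (c < a) = false by lia.
  by rewrite ab /= ca /= cb ?ca.
elim: rs => [|r rs IH] //= /andP[sr srs].
by apply: knuth_xzy_row => //; apply: IH.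
Qed.

(** * Knuth relations for zeros inserted from different rows *)

Definition insert0_at (i : nat) (rs : seq (seq nat)) : seq (seq nat) :=
  take i rs ++ insert_rows (drop i rs) 0.

Lemma insert0_at0 rs : insert0_at 0 rs = insert_rows rs 0.
Proof. by rewrite /insert0_at take0 drop0. Qed.

Lemma insert0_atS i r rs : insert0_at i.+1 (r :: rs) = r :: insert0_at i rs.
Proof. by []. Qed.

Lemma insert0_at_sorted i rs :
  all (sorted leq) rs -> all (sorted leq) (insert0_at i rs).
Proof.
rewrite -{1}[rs](cat_take_drop i) !all_cat => /andP[-> /=].
exact: insert_rows_sorted.
Qed.

(** This is [knuth_yxz] with a zero as smallest letter, entering [z] rows further down. Until then
    [a] and [c] bump letters in the same weak order, and [0 < a + z] makes the first of them
    positive when it meets the zero. *)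
Lemma insert0_at_letters z rs a c : all (sorted leq) rs -> a <= c ->
  0 < a + z ->
  insert_rows (insert0_at z (insert_rows rs a)) c =
  insert0_at z (insert_rows (insert_rows rs a) c).
Proof.
elim: z rs a c => [|z IH] rs a c srs ac az.
  by rewrite !insert0_at0 (insert_knuth_yxz srs) // -(addn0 a) az addn0.
(* Inserting [a] gives the same result in no row as in one empty row. *)
have {srs} : exists r rs', [/\ sorted leq r, all (sorted leq) rs'
    & insert_rows rs a = insert_rows (r :: rs') a].
  case: rs srs => [|r rs' /andP[sr srs']]; first by exists [::], [::].
  by exists r, rs'.
case=> r [rs' [sr srs ->]].
rewrite !(insert_rows_cons, insert0_atS).
congr (_ :: _).
case E: (row_insert r a).2 => [d|] /=; last first.
  by rewrite (row_insert_weak_None ac E).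
case F: (row_insert _ c).2 => [e|] //=; apply: IH => //.
  exact: row_insert_weak sr ac E F.
by rewrite addn_gt0 (leq_ltn_trans _ (bumped_gt E)).
Qed.

Lemma insert0_at2_letter y z rs c : all (sorted leq) rs -> y < z ->
  y <= size rs ->
  insert_rows (insert0_at z (insert0_at y rs)) c =
  insert0_at z (insert_rows (insert0_at y rs) c).
Proof.
elim: y z rs c => [|y IH] z rs c srs.
  by move=> z0 _; rewrite insert0_at0 insert0_at_letters.
case: z rs srs => // z [|r rs] // /andP[sr srs] yz ys.
rewrite !(insert_rows_cons, insert0_atS).
by case: (row_insert r c).2 => //= d; rewrite IH.
Qed.

(** A zero that starts lower acts as a smaller letter, so this is [knuth_yxz] for zeros inserted in
    the order [y, z, x]. Rows above row [x] are peeled off first. *)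
Lemma insert0_at_xzy x y z rs : all (sorted leq) rs -> x <= y < z ->
  y <= size rs ->
  insert0_at x (insert0_at z (insert0_at y rs)) =
  insert0_at z (insert0_at x (insert0_at y rs)).
Proof.
elim: x y z rs => [|x IH] y z rs srs xyz ys.
  by rewrite !(insert0_at0 (insert0_at _ _)) insert0_at2_letter //; lia.
case: y z rs srs xyz ys => [|y] [|z] [|r rs] //; rewrite ?andbF //.
move=> /andP[_ srs] xyz ys.
by rewrite !insert0_atS IH.
Qed.

(** For [z = 0] this is [knuth_xzy] with smallest letter 0. In the rows above the zero, [c] bumps a
    letter at most [b], so the strict order persists. *)
Lemma letters_insert0_at z rs b c : all (sorted leq) rs -> c < b ->
  z <= size rs ->
  insert_rows (insert_rows (insert0_at z rs) b) c =
  insert_rows (insert0_at z (insert_rows rs b)) c.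
Proof.
elim: z rs b c => [|z IH] rs b c srs cb.
  by move=> _; rewrite !insert0_at0 (insert_knuth_xzy srs).
case: rs srs => [|r rs] // /andP[sr srs] zs.
rewrite !(insert_rows_cons, insert0_atS); congr (_ :: _).
have [e -> leb] := row_insert_strict r cb.
case E: (row_insert r b).2 => [d|] //=; apply: IH => //.
exact: leq_ltn_trans leb (bumped_gt E).
Qed.

Lemma letter_insert0_at2 y z rs b : all (sorted leq) rs -> y <= z ->
  0 < b + y -> z <= size rs ->
  insert0_at y (insert_rows (insert0_at z rs) b) =
  insert0_at y (insert0_at z (insert_rows rs b)).
Proof.
elim: y z rs b => [|y IH] z rs b srs yz b0 zs.
  by rewrite !(insert0_at0 (_ _ _)) letters_insert0_at //; rewrite addn0 in b0.
case: z rs srs yz zs => // z [|r rs] // /andP[sr srs] yz zs.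
rewrite !(insert_rows_cons, insert0_atS).
congr (_ :: _); case E: (row_insert r b).2 => [d|] //=; apply: IH => //.
by rewrite addn_gt0 (leq_ltn_trans _ (bumped_gt E)).
Qed.

(** With lower rows again acting as smaller letters, this is [knuth_xzy] for zeros inserted in the
    order [z, x, y]. *)
Lemma insert0_at_yxz x y z rs : all (sorted leq) rs -> x < y <= z ->
  z <= size rs ->
  insert0_at y (insert0_at x (insert0_at z rs)) =
  insert0_at y (insert0_at z (insert0_at x rs)).
Proof.
elim: x y z rs => [|x IH] y z rs srs /andP[xy yz] zs.
  by rewrite !insert0_at0 letter_insert0_at2.
case: y z rs srs xy yz zs => [|y] [|z] [|r rs] // /andP[_ srs] xy yz zs.
by rewrite !insert0_atS IH //; apply/andP.
Qed.

(** * Internal insertion on the zero-filled tableau *)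

Fixpoint zero_fill (m : seq nat) (rs : seq (seq nat)) : seq (seq nat) :=
  if rs is r :: rs' then
    (nseq (head 0 m) 0 ++ r) :: zero_fill (behead m) rs'
  else [::].

Lemma size_zero_fill m rs : size (zero_fill m rs) = size rs.
Proof. by elim: rs m => //= r rs IH m; rewrite IH. Qed.

Lemma zero_fill_inj m : injective (zero_fill m).
Proof.
move=> rs rs'; elim: rs m rs' => [|r rs IH] m [|r' rs'] //= [e /IH ->].
by move/eqP: e; rewrite eqseq_cat // => /andP[_ /eqP ->].
Qed.

Lemma zero_fill_sorted m rs :
  all (sorted leq) rs -> all (sorted leq) (zero_fill m rs).
Proof.
elim: rs m => //= r rs IH m /andP[sr srs]; rewrite IH // andbT.
elim: (head 0 m) => //= k; case: k => [|k] //= _.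
by case: r sr => //= x r ->.
Qed.

Lemma row_insert_zeros k r x :
  row_insert (nseq k 0 ++ r) x =
  (nseq k 0 ++ (row_insert r x).1, (row_insert r x).2).
Proof. by elim: k => [|k /= ->] //=; case: row_insert. Qed.

Lemma zero_fill_insert m rs x : size m <= size rs ->
  zero_fill m (insert_rows rs x) = insert_rows (zero_fill m rs) x.
Proof.
elim: rs m x => [|r rs IH] m x ms; first by case: m ms.
rewrite insert_rows_cons [zero_fill m (r :: rs)]/= insert_rows_cons.
rewrite row_insert_zeros /=; congr (_ :: _).
case: (row_insert r x).2 => //= y; apply: IH.
by case: m ms.
Qed.

Definition phi_rows (i : nat) (rs : seq (seq nat)) : seq (seq nat) :=
  if nth [::] rs i is x :: r
  then take i rs ++ r :: insert_rows (drop i.+1 rs) x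
  else set_nth [::] rs i [::].

Lemma phi_rowsS i r rs : phi_rows i.+1 (r :: rs) = r :: phi_rows i rs.
Proof. by rewrite /phi_rows /=; case: nth. Qed.

(** The 0 passes the zeros of row [i], then displaces the first skew entry, which is positive, or is
    appended if there is none. In both cases it marks the new inner cell. *)
Lemma zero_fill_phi i m rs : all (all (leq 1)) rs -> size m <= size rs ->
  i <= size rs ->
  zero_fill (incr_nth m i) (phi_rows i rs) = insert0_at i (zero_fill m rs).
Proof.
elim: i m rs => [|i IH] m rs pos ms irs.
  rewrite insert0_at0 /phi_rows.
  case: rs pos ms irs => [|[|x r] rs] pos ms _; first by case: m ms.
    rewrite [zero_fill m _]/= insert_rows_cons row_insert_zeros /=.
    congr (_ :: _); last by case: m ms.
    by rewrite cats0; case: m ms => // k m _; rewrite -(nseqD _ 1) addn1.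
  rewrite [zero_fill m _]/= insert_rows_cons row_insert_zeros /=.
  have x0 : 0 < x by case/andP: pos => /andP[].
  rewrite x0 drop0 /= -zero_fill_insert; last by case: m ms.
  congr (_ :: _); last by case: m ms.
  rewrite -cat_rcons -cats1 -(nseqD _ 1) addn1.
  by case: m ms.
case: rs pos ms irs => // r rs /andP[_ pos] ms irs.
rewrite phi_rowsS [zero_fill m _]/= insert0_atS -IH //; last by case: m ms.
by case: m {ms} => [|k m] //; case: {IH irs} i.
Qed.

Lemma insert_rows_positive rs x :
  0 < x -> all (all (leq 1)) rs -> all (all (leq 1)) (insert_rows rs x).
Proof.
elim: rs x => [|r rs IH] x x0; first by rewrite /= x0.
case/andP=> pr prs; rewrite insert_rows_cons.
have p1 : all (leq 1) (row_insert r x).1.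
  elim: r pr => [|y r IHr] /=; first by rewrite x0.
  by case/andP=> y0 pr; case: (ltnP x y) => _ /=; rewrite ?x0 // y0 IHr.
apply/andP; split=> //.
case E: (row_insert r x).2 => [y|] //=; apply: IH => //.
exact: leq_trans x0 (ltnW (bumped_gt E)).
Qed.

Lemma phi_rows_positive i rs :
  all (all (leq 1)) rs -> all (all (leq 1)) (phi_rows i rs).
Proof.
elim: i rs => [|i IH] [|r rs] //; rewrite /phi_rows.
- case: r => [|x r] //= /andP[/andP[x0 ->]] /=; rewrite drop0.
  exact: insert_rows_positive.
- by move=> _; rewrite nth_nil set_nth_nil /=; elim: i {IH}.
by rewrite -/(phi_rows i.+1 (r :: rs)) phi_rowsS /= => /andP[-> /IH].
Qed.

(** The invariant kept along a word; it supplies what the relations between zero insertions use. *)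
Definition fillable (T : skewtab) : bool :=
  [&& size (inner T) <= size (rows T), all (all (leq 1)) (rows T)
    & all (sorted leq) (zero_fill (inner T) (rows T))].

Definition corner_row (m : seq nat) (i : nat) : bool :=
  if i is i'.+1 then nth 0 m i < nth 0 m i' else true.

Lemma corner_row_size m i : corner_row m i -> i <= size m.
Proof.
case: i => //= i; case: (ltnP i (size m)) => // le.
by rewrite (nth_default 0 le).
Qed.

Lemma insert_rows_size rs x : size rs <= size (insert_rows rs x).
Proof.
elim: rs x => // r rs IH x; rewrite insert_rows_cons /= ltnS.
by case: (row_insert r x).2 => //= y.
Qed.

Lemma phi_fillable T i : fillable T -> corner_row (inner T) i ->
  let T' := SkewTab (incr_nth (inner T) i) (phi_rows i (rows T)) in
  phi i T = Some T' /\ fillable T'.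
Proof.
case: T => m rs /and3P[/= ms pos sr] ci.
have im := corner_row_size ci; have irs := leq_trans im ms.
split.
  rewrite /phi; have -> : inner_corner (SkewTab m rs) i (mu (SkewTab m rs) i).
    rewrite /inner_corner eqxx orbT /in_shape /=; apply/andP; split.
      case: i ci {im irs} => //= i ci.
      by rewrite /mu /= leqNgt ci.
    by case E: (mu _ i) => [|j] //; rewrite ltnn.
  by congr Some; rewrite /row /phi_rows /=; case: nth.
apply/and3P; split=> /=.
- rewrite -(size_zero_fill (incr_nth m i)) zero_fill_phi //.
  rewrite /insert0_at size_cat.
  have := insert_rows_size (drop i (zero_fill m rs)) 0.
  rewrite size_drop size_takel ?size_zero_fill // size_incr_nth.
  case: ltnP => [_ | mi]; first by lia.
  (* The inner shape gains a row; if the outer shape has no row there, the inserted 0 creates it. *)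
  have {im mi} -> : i = size m by lia.
  case: (ltnP (size m) (size rs)) => [|le]; first by lia.
  rewrite drop_oversize ?size_zero_fill //=; lia.
- exact: phi_rows_positive.
by rewrite zero_fill_phi //; apply: insert0_at_sorted.
Qed.

(** * Yamanouchi words relative to an inner shape *)

Definition add_word (m : seq nat) (w : seq nat) : seq nat :=
  foldr (fun i m' => incr_nth m' i) m w.

Lemma nth_add_word m w i : nth 0 (add_word m w) i = nth 0 m i + count_mem i w.
Proof.
elim: w => [|j w IH] /=; first by rewrite addn0.
by rewrite nth_incr_nth IH addnCA.
Qed.

Definition dominates (m w : seq nat) : Prop := forall i,
  nth 0 m i.+1 + count_mem i.+1 w <= nth 0 m i + count_mem i w.

(** For empty [m] these are the ordinary Yamanouchi words. *)
Fixpoint yamanouchi (m w : seq nat) : Prop :=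
  dominates m w /\ if w is _ :: w' then yamanouchi m w' else True.

Lemma yamanouchi_dominates m w : yamanouchi m w -> dominates m w.
Proof. by case: w => [|i w] []. Qed.

Lemma yamanouchi_catr m w1 w2 : yamanouchi m (w1 ++ w2) -> yamanouchi m w2.
Proof. by elim: w1 => [|i w1 IH] //= [_ /IH]. Qed.

Lemma yamanouchi_corner m i w :
  yamanouchi m (i :: w) -> corner_row (add_word m w) i.
Proof.
case: i => //= i [/(_ i) + _].
by rewrite !nth_add_word /=; lia.
Qed.

Lemma phi_word_fillable T w : fillable T -> yamanouchi (inner T) w ->
  exists T', [/\ phi_word w T = Some T', fillable T',
    inner T' = add_word (inner T) w
    & zero_fill (inner T') (rows T') =
      foldr insert0_at (zero_fill (inner T) (rows T)) w].
Proof.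
move=> fT; elim: w => [|i w IH] Y; first by exists T.
have [T1 [e1 f1 i1 z1]] := IH (yamanouchi_catr (w1 := [:: i]) Y).
have ci := yamanouchi_corner Y; rewrite -i1 in ci.
have [e2 f2] := phi_fillable f1 ci.
exists (SkewTab (incr_nth (inner T1) i) (phi_rows i (rows T1))).
case/and3P: f1 => ms pos _; have im := corner_row_size ci.
split=> //=; first by rewrite -/(phi_word w T) e1 /=.
  by rewrite i1.
by rewrite zero_fill_phi ?z1 // (leq_trans im).
Qed.

(** * Invariance under Knuth equivalence *)

Definition interchangeable (T : skewtab) (u v : seq nat) : Prop :=
  [/\ yamanouchi (inner T) u <-> yamanouchi (inner T) v,
      add_word (inner T) u = add_word (inner T) v
    & yamanouchi (inner T) u ->
      foldr insert0_at (zero_fill (inner T) (rows T)) u =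
      foldr insert0_at (zero_fill (inner T) (rows T)) v].

Lemma yamanouchi_cat_congr m a u v : perm_eq u v ->
  (yamanouchi m u <-> yamanouchi m v) ->
  (yamanouchi m (a ++ u) <-> yamanouchi m (a ++ v)).
Proof.
move=> /permP uv E; elim: a => [|i a IH] //=.
have -> : dominates m (i :: a ++ u) <-> dominates m (i :: a ++ v).
  by split=> D j; move: (D j); rewrite /= !count_cat !uv.
by rewrite IH.
Qed.

(** Exchanging [x] and [z] alters one suffix, and only [z = x + 1] could do harm. Then [y] is [x] in
    the first relation, so its box in row [x] is already there to support row [z]; in the second [y]
    is [z], and room for two boxes in row [z] after [x] leaves room for one before it. *)
Lemma yamanouchi_knuth m u v :
  knuth_step u v -> yamanouchi m u <-> yamanouchi m v.
Proof.
case=> a b x y z xyz; apply: yamanouchi_cat_congr;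
  rewrite ?perm_cat2r ?perm_cons //.
- by rewrite -[[:: x; z; y]]/([:: x] ++ [:: z] ++ [:: y]) perm_catCA.
- split=> /= -[D1 [D2 [D3 Y]]]; have D4 := yamanouchi_dominates Y;
    split; [|split; [|by split] | |split; [|by split]];
    move=> i; move: (D1 i) (D2 i) (D3 i) (D4 i) xyz; rewrite /=; lia.
- by rewrite -[[:: x; z]]/([:: x] ++ [:: z]) perm_catC.
split=> /= -[D1 [D2 [D3 Y]]]; have D4 := yamanouchi_dominates Y;
    split; [|split; [|split] | |split; [|split]] => //;
    move=> i; move: (D1 i) (D2 i) (D3 i) (D4 i) xyz; rewrite /=; lia.
Qed.

Lemma interchangeable_knuth T u v :
  fillable T -> knuth_step u v -> interchangeable T u v.
Proof.
move=> fT uv; split; first exact: yamanouchi_knuth.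
  case: uv => a b x y z _; rewrite /add_word !foldr_cat /=; congr foldr.
    by rewrite incr_nthC.
  by congr incr_nth; rewrite incr_nthC.
case: uv => a b x y z xyz Y; rewrite !foldr_cat /=; congr foldr.
  have Yb := yamanouchi_catr (w1 := [:: x; z]) (yamanouchi_catr Y).
  have [T' [_ /and3P[ms _ sr] iT zT]] :=
    phi_word_fillable fT (yamanouchi_catr (w1 := [:: y]) Yb).
  rewrite -zT; apply: insert0_at_xzy => //.
  (* Row [y] is addable to the inner shape reached after [b], hence at most its number of rows. *)
  rewrite size_zero_fill (leq_trans _ ms) //.
  by apply: corner_row_size; rewrite iT; apply: yamanouchi_corner.
have Yb := yamanouchi_catr (w1 := [:: y; x]) (yamanouchi_catr Y).
have [T' [_ /and3P[ms _ sr] iT zT]] :=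
    phi_word_fillable fT (yamanouchi_catr (w1 := [:: z]) Yb).
rewrite -zT; apply: insert0_at_yxz => //.
rewrite size_zero_fill (leq_trans _ ms) //.
by apply: corner_row_size; rewrite iT; apply: yamanouchi_corner.
Qed.

(** [interchangeable] is an equivalence relation: its first clause carries the conditional third one
    through symmetry and transitivity. *)
Lemma interchangeable_knuth_equiv T u v :
  fillable T -> knuth_equiv u v -> interchangeable T u v.
Proof.
move=> fT; elim=> {u v} [u v | u | u v _ [] | u v w _ [Y1 A1 F1] _ [Y2 A2 F2]].
- exact: interchangeable_knuth.
- by split.
- by move=> Y A F; split=> //; [rewrite Y | move/Y/F].
split; [by rewrite Y1 | by rewrite A1 |].
by move=> Y; rewrite F1 // F2 //; apply/Y1.
Qed.

Lemma phi_word_knuth_equiv T u v : fillable T -> yamanouchi (inner T) u ->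
  knuth_equiv u v ->
  yamanouchi (inner T) v /\
  exists T', phi_word u T = Some T' /\ phi_word v T = Some T'.
Proof.
move=> fT Yu uv; have [Y A F] := interchangeable_knuth_equiv fT uv.
have Yv : yamanouchi (inner T) v by apply/Y.
split=> //.
have [T1 [e1 _ i1 z1]] := phi_word_fillable fT Yu.
have [T2 [e2 _ i2 z2]] := phi_word_fillable fT Yv.
exists T1; split=> //; rewrite e2; congr Some.
(* With equal inner shapes, equal zero-filled rows have equal skew parts. *)
have i12 : inner T2 = inner T1 by rewrite i1 i2 A.
have := F Yu; rewrite -z1 -z2 i12 => /zero_fill_inj e.
by case: T1 T2 e i12 {e1 e2 i1 i2 z1 z2} => m1 r1 [m2 r2] /= -> ->.
Qed.

(** * Insertion order words are relative Yamanouchi words *)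

Lemma nth_outer T i : size (inner T) <= size (rows T) ->
  nth 0 (outer T) i = mu T i + size (row T i).
Proof.
move=> ms; rewrite /outer; case: (ltnP i (size (rows T))) => ir.
  by rewrite nth_mkseq.
rewrite nth_default ?size_mkseq //.
by rewrite /mu /row !nth_default // (leq_trans ms).
Qed.

Lemma mem_cells T i j : ((i, j) \in cells T) = in_shape T i j.
Proof.
rewrite /in_shape.
apply/allpairsPdep/andP => [[i' [j' [+ + [-> ->]]]] | [mj jo]].
  rewrite !mem_iota /= add0n => ir /andP[-> jo].
  by rewrite /outer nth_mkseq.
have ir : i < size (rows T).
  by rewrite ltnNge; apply/negP => le; rewrite nth_default ?size_mkseq in jo.
exists i, j; rewrite !mem_iota /= mj ir; split=> //.
by move: jo; rewrite nth_mkseq.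
Qed.

Lemma cells_uniq T : uniq (cells T).
Proof.
apply: allpairs_uniq_dep => [|i _|]; rewrite ?iota_uniq //.
by move=> [i j] [i' j'] _ _ /= [-> ->].
Qed.

Lemma std_before_trans T : transitive (std_before T).
Proof. by move=> c d e; rewrite /std_before /=; lia. Qed.

Lemma std_before_irr T : irreflexive (std_before T).
Proof. by move=> c; rewrite /std_before /=; lia. Qed.

Lemma count_sorted_before (A : eqType) (lt : rel A) x0 s k :
  transitive lt -> irreflexive lt -> sorted lt s -> k < size s ->
  count (fun d => lt d (nth x0 s k)) s = k.
Proof.
move=> tr irr; elim: s k => [|x s IH] // [|k] /= xs.
  move=> _; rewrite irr add0n; apply/eqP; rewrite -leqn0 leqNgt -has_count.
  apply/hasPn => y ys; apply/negP => yx.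
  by have := tr _ _ _ yx (allP (order_path_min tr xs) _ ys); rewrite irr.
rewrite ltnS => ks; rewrite (allP (order_path_min tr xs)) ?mem_nth //.
by rewrite IH // (path_sorted xs).
Qed.

Lemma std_entry_index U s c : perm_eq s (cells U) ->
  sorted (std_before U) s -> c \in s -> std_entry U c.1 c.2 = (index c s).+1.
Proof.
move=> /permP ps ss cs; rewrite /std_entry -ps -surjective_pairing; congr _.+1.
rewrite -{1}(nth_index c cs).
rewrite (count_sorted_before _ (@std_before_trans U) (@std_before_irr U)) //.
by rewrite index_mem.
Qed.

(** In a sorted list of the cells, the standardised entry of a cell is its index plus one. *)
Lemma companion_sorted U s : perm_eq s (cells U) ->
  sorted (std_before U) s -> companion U = rev [seq c.1 | c <- s].
Proof.
move=> ps ss; rewrite /companion -(perm_size ps); congr rev.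
have us : uniq s by rewrite (perm_uniq ps) cells_uniq.
apply: (@eq_from_nth _ 0) => [|k]; rewrite !size_map size_iota // => ks.
rewrite (nth_map 0) ?size_iota // (nth_map (0, 0)) // nth_iota // add1n.
set c := nth (0, 0) s k; have cs : c \in s by apply: mem_nth.
have ec : std_entry U c.1 c.2 = k.+1.
  by rewrite (std_entry_index ps ss) // index_uniq.
have in_row i j : (i, j) \in cells U ->
    std_entry U i j \in nth [::] (rows (std U)) i /\ i < size (rows U).
  case/allpairsPdep=> i' [j' []]; rewrite mem_iota /= add0n => i's js [-> ->].
  by rewrite nth_mkseq // map_f.
rewrite /row_of; case: findP => [/hasPn no | i].
  have [] := in_row c.1 c.2.
    by rewrite -surjective_pairing -(perm_mem ps).
  rewrite ec => kr c1; have := no (nth [::] (rows (std U)) c.1).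
  by rewrite kr mem_nth ?size_mkseq // => /(_ isT).
rewrite size_mkseq => ir /(_ [::]) + _; rewrite nth_mkseq // => /mapP[j ji ek].
have ijs : (i, j) \in s.
  by rewrite (perm_mem ps); apply/allpairsPdep; exists i, j; rewrite mem_iota.
have := std_entry_index ps ss ijs; rewrite /= -ek => -[kE].
by rewrite /c kE nth_index.
Qed.

Lemma part_nth_le p i j : is_part p -> i <= j -> nth 0 p j <= nth 0 p i.
Proof.
case/andP=> sp _ ij; case: (ltnP j (size p)) => js; last first.
  by rewrite (nth_default _ js).
have geq_trans : transitive geq by move=> x y z; lia.
by apply: (sorted_leq_nth geq_trans leqnn 0 sp) => //; rewrite inE; lia.
Qed.

Lemma column_strict T i i' j : semistandard T -> i < i' ->
  in_shape T i j -> in_shape T i' j -> entry T i j < entry T i' j.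
Proof.
move=> sT; elim: i' => // i' IH; rewrite ltnS leq_eqVlt => /orP[/eqP -> | ii'].
  exact: col_strict.
move=> ij i'j; have i'j' : in_shape T i' j.
  case/andP: ij => mj _; case/andP: i'j => _ jo; apply/andP; split.
    exact: leq_trans (part_nth_le (inner_part sT) (ltnW ii')) mj.
  exact: leq_trans jo (part_nth_le (outer_part sT) (leqnSn _)).
exact: ltn_trans (IH ii' ij i'j') (col_strict sT i'j' i'j).
Qed.

(** Distinct cells are strictly comparable, since equal entries never share a column. *)
Lemma exists_sorted_cells T : semistandard T ->
  exists2 s, perm_eq s (cells T) & sorted (std_before T) s.
Proof.
move=> sT; pose le c d := ~~ std_before T d c.
exists (sort le (cells T)); first by rewrite perm_sort.
have le_tr : transitive le by move=> c d e; rewrite /le /std_before; lia.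
have le_tot : total le by move=> c d; rewrite /le /std_before; lia.
have := sort_sorted le_tot (cells T).
have : uniq (sort le (cells T)) by rewrite sort_uniq cells_uniq.
rewrite !sorted_pairwise //; last exact: std_before_trans.
rewrite uniq_pairwise => u p.
have {u p} : pairwise (fun c d => (c != d) && le c d) (sort le (cells T)).
  by rewrite pairwise_relI u.
apply: (@sub_in_pairwise _ (mem (cells T))); last first.
  by apply/allP => c; rewrite mem_sort.
move=> [i j] [i' j'] /=; rewrite !mem_cells => cs ds /andP[ne].
rewrite /le /std_before /=.
have [jj | jj] := eqVneq j j'; last by lia.
move: jj ds ne => <- ds ne.
case: (ltngtP i i') => [lt | lt | ii'].
- by have := column_strict sT lt cs ds; lia.
- by have := column_strict sT lt ds cs; lia.
by rewrite ii' eqxx in ne.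
Qed.

Lemma count_mem_map_fst (s : seq (nat * nat)) i :
  count_mem i [seq c.1 | c <- s] = size [seq c.2 | c <- s & c.1 == i].
Proof. by rewrite count_map size_map size_filter. Qed.

(** Every column occupied in row [i.+1], by an inner cell or a cell of [s1], is also occupied in row
    [i]; counting columns gives the inequality. *)
Lemma sorted_prefix_dominates T s1 s2 : semistandard T ->
  perm_eq (s1 ++ s2) (cells T) -> sorted (std_before T) (s1 ++ s2) ->
  dominates (inner T) [seq c.1 | c <- s1].
Proof.
move=> sT ps; rewrite sorted_pairwise; last exact: std_before_trans.
rewrite pairwise_cat => /and3P[/allrelP ss _ _] i.
have s1T c : c \in s1 -> in_shape T c.1 c.2.
  move=> c1; rewrite -mem_cells -surjective_pairing -(perm_mem ps).
  by rewrite mem_cat c1.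
have u1 : uniq s1.
  by have := cells_uniq T; rewrite -(perm_uniq ps) cat_uniq => /and3P[].
rewrite !count_mem_map_fst -{1}(size_iota 0 (nth 0 _ i.+1)) -size_cat.
rewrite -{1}(size_iota 0 (nth 0 _ i)) -size_cat; apply: uniq_leq_size => [|j].
  rewrite cat_uniq iota_uniq map_inj_in_uniq ?filter_uniq ?andbT //=;
    last first.
    move=> [a b] [a' b']; rewrite !mem_filter /=.
    move=> /andP[/eqP-> _] /andP[/eqP-> _].
    by move=> ->.
  apply/hasPn => _ /mapP[[a b] + ->].
  rewrite mem_filter /= => /andP[/eqP-> /s1T].
  by rewrite mem_iota /= add0n -leqNgt => /andP[].
rewrite !mem_cat => /orP[| /mapP[[a b] + /= ->]].
  have := part_nth_le (inner_part sT) (leqnSn i).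
  by rewrite !mem_iota /=; lia.
rewrite mem_filter /= => /andP[/eqP -> bs]; rewrite mem_iota /= add0n.
case: ltnP => //= mb; apply/mapP; exists (i, b) => //.
rewrite mem_filter eqxx /=.
have ib : in_shape T i b.
  case/andP: (s1T _ bs) => _ bo; rewrite /in_shape mb /=.
  exact: leq_trans bo (part_nth_le (outer_part sT) (leqnSn i)).
have := ib; rewrite -mem_cells -(perm_mem ps) mem_cat => /orP[//|ib2].
(* The cell above has a smaller entry, so it cannot come later in [s2]. *)
have := ss _ _ bs ib2; have := col_strict sT ib (s1T _ bs).
by rewrite /std_before /=; lia.
Qed.

Lemma companion_yamanouchi T :
  semistandard T -> yamanouchi (inner T) (companion T).
Proof.
move=> sT; have [s ps ss] := exists_sorted_cells sT.
rewrite (companion_sorted ps ss) -map_rev.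
suff Y s1 s2 : s = s1 ++ s2 -> yamanouchi (inner T) [seq c.1 | c <- rev s1].
  by apply: (Y s [::]); rewrite cats0.
have D s1' s2' : s = s1' ++ s2' -> dominates (inner T) [seq c.1 | c <- rev s1'].
  move=> es i; rewrite map_rev !count_rev.
  by apply: (sorted_prefix_dominates (s2 := s2')) i => //; rewrite -es.
elim/last_ind: s1 s2 => [|s1 c IH] s2 es.
  by split=> //; apply: (D [::] s).
rewrite rev_rcons /=; split; last by apply: (IH (c :: s2)); rewrite -cat_rcons.
by have := D _ _ es; rewrite rev_rcons.
Qed.

(** * The standard tableau of a Yamanouchi word *)

Definition letter_positions (i : nat) (t : seq nat) : seq nat :=
  [seq p <- iota 0 (size t) | nth 0 t p == i].

Lemma size_letter_positions i t : size (letter_positions i t) = count_mem i t.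
Proof.
rewrite size_filter -[in RHS](mkseq_nth 0 t) count_map.
by apply: eq_count.
Qed.

Lemma mem_letter_positions i t p :
  (p \in letter_positions i t) = (p < size t) && (nth 0 t p == i).
Proof. by rewrite mem_filter mem_iota /= add0n andbC. Qed.

Lemma letter_positions_sorted i t : sorted ltn (letter_positions i t).
Proof. by apply: sorted_filter (iota_ltn_sorted _ _); apply: ltn_trans. Qed.

Lemma letter_positions_take i t p : p <= size t ->
  letter_positions i t =
  letter_positions i (take p t) ++
  [seq q <- iota p (size t - p) | nth 0 t q == i].
Proof.
move=> ps; rewrite /letter_positions -{1}(subnKC ps) iotaD filter_cat add0n.
congr (_ ++ _); rewrite size_takel //; apply: eq_in_filter => q.
by rewrite mem_iota => /andP[_ qp]; rewrite nth_take.
Qed.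

Lemma nth_letter_positions t p : p < size t ->
  nth 0 (letter_positions (nth 0 t p) t) (count_mem (nth 0 t p) (take p t)) = p.
Proof.
move=> ps; rewrite (letter_positions_take _ (ltnW ps)) nth_cat.
rewrite size_letter_positions ltnn subnn.
rewrite -(ltn_predK (n := size t - p) (m := 0)) ?subn_gt0 //.
by rewrite /= eqxx.
Qed.

Lemma count_take_letter_position i t k : k < count_mem i t ->
  let p := nth 0 (letter_positions i t) k in
  [/\ p < size t, nth 0 t p = i & count_mem i (take p t) = k].
Proof.
move=> kc p; have ks : k < size (letter_positions i t).
  by rewrite size_letter_positions.
have := mem_nth 0 ks; rewrite mem_letter_positions -/p => /andP[ps /eqP ti].
split=> //; have := nth_letter_positions ps; rewrite ti => e.
have cs : count_mem i (take p t) < size (letter_positions i t).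
  rewrite size_letter_positions -{2}(cat_take_drop p t).
  rewrite (drop_nth 0) // count_cat.
  by rewrite /= ti eqxx; lia.
apply/eqP; rewrite -(nth_uniq 0 cs ks) ?e //.
by apply: (sorted_uniq ltn_trans ltnn); apply: letter_positions_sorted.
Qed.

Lemma add_word_part m w : is_part m -> yamanouchi m w -> is_part (add_word m w).
Proof.
move=> pm Y; apply/andP; split.
  apply/(sortedP 0) => i _; rewrite /= !nth_add_word.
  exact: yamanouchi_dominates.
elim: w Y => [|i w IH] Y; first by case/andP: pm.
have {}IH := IH (yamanouchi_catr (w1 := [:: i]) Y).
(* Thus [incr_nth] never pads the shape with zero parts. *)
have ic := corner_row_size (yamanouchi_corner Y).
rewrite /=; elim: (add_word m w) i IH ic {Y} => [|x s IHs] [|i] //=.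
  by rewrite !inE !negb_or => /andP[_ ->].
by rewrite !inE !negb_or => /andP[-> /= ns] /IHs ->.
Qed.

Lemma size_add_word m w : size m <= size (add_word m w).
Proof.
elim: w => //= i w IH; rewrite size_incr_nth; case: ifP => // /negbT.
by rewrite -leqNgt => le; apply: leq_trans IH (leqW le).
Qed.

(** The standard tableau whose entry [p.+1] lies in the row given by the [p]-th
    letter of [w] from the right. *)
Definition word_tab (m w : seq nat) : skewtab :=
  SkewTab m (mkseq (fun i => [seq p.+1 | p <- letter_positions i (rev w)])
                   (size (add_word m w))).

Lemma row_word_tab m w i :
  row (word_tab m w) i = [seq p.+1 | p <- letter_positions i (rev w)].
Proof.
rewrite /row /=; case: (ltnP i (size (add_word m w))) => le.
  by rewrite nth_mkseq.
rewrite nth_default ?size_mkseq //; symmetry; apply/nilP.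
rewrite /nilp size_map size_letter_positions count_rev.
by have := nth_add_word m w i; rewrite (nth_default 0 le); lia.
Qed.

Lemma outer_word_tab m w : outer (word_tab m w) = add_word m w.
Proof.
rewrite /outer size_mkseq -[RHS](mkseq_nth 0); apply: eq_mkseq => i.
by rewrite row_word_tab size_map size_letter_positions count_rev nth_add_word.
Qed.

Lemma in_shape_word_tab m w i j : in_shape (word_tab m w) i j =
  (nth 0 m i <= j) && (j - nth 0 m i < count_mem i (rev w)).
Proof.
rewrite /in_shape outer_word_tab nth_add_word count_rev /mu /=; lia.
Qed.

Lemma entry_word_tab m w i j : in_shape (word_tab m w) i j ->
  entry (word_tab m w) i j =
  (nth 0 (letter_positions i (rev w)) (j - nth 0 m i)).+1.
Proof.
rewrite in_shape_word_tab => /andP[_ js].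
by rewrite /entry row_word_tab (nth_map 0) // size_letter_positions.
Qed.

Lemma yamanouchi_take m w p :
  yamanouchi m w -> dominates m (take p (rev w)).
Proof.
rewrite -{1}(cat_take_drop (size w - p) w) => /yamanouchi_catr.
by move=> /yamanouchi_dominates D i; rewrite take_rev !count_rev.
Qed.

Lemma word_tab_semistandard m w :
  is_part m -> yamanouchi m w -> semistandard (word_tab m w).
Proof.
move=> pm Y; split=> //.
- by rewrite outer_word_tab add_word_part.
- by rewrite size_mkseq size_add_word.
- by move=> i j ij; rewrite entry_word_tab.
- move=> i j ij ij'; rewrite !entry_word_tab // ltnS ltnW //.
  move: ij ij'; rewrite !in_shape_word_tab => /andP[mj jc] /andP[_ jc'].
  apply: (sorted_ltn_nth ltn_trans 0 (letter_positions_sorted _ _));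
    rewrite ?inE ?size_letter_positions //.
  by rewrite subSn.
move=> i j ij ij'; rewrite !entry_word_tab // ltnS.
move: ij ij'; rewrite !in_shape_word_tab => /andP[mj jc] /andP[mj' jc'].
have [/= ps ti ck] := count_take_letter_position jc'.
set p := nth 0 (letter_positions i.+1 _) _ in ps ti ck *.
have jp : j - nth 0 m i < count_mem i (take p (rev w)).
  (* The prefix ending with the letter at [p] fills [(i.+1, j)], so it also fills [(i, j)], and does
     so before [p]. *)
  have := yamanouchi_take p.+1 Y i.
  rewrite (take_nth 0) // -cats1 !count_cat /= ti eqxx ck.
  lia.
rewrite (letter_positions_take _ (ltnW ps)) nth_cat size_letter_positions jp.
have : nth 0 (letter_positions i (take p (rev w))) (j - nth 0 m i)
    \in letter_positions i (take p (rev w)).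
  by rewrite mem_nth // size_letter_positions.
by rewrite mem_letter_positions size_takel ?(ltnW ps) // => /andP[].
Qed.

Lemma companion_word_tab m w :
  is_part m -> yamanouchi m w -> companion (word_tab m w) = w.
Proof.
move=> pm Y; set t := rev w.
(* The cell that receives the entry [p.+1]: its column counts the inner cells and earlier boxes of
   its row. *)
pose cell p :=
  (nth 0 t p, nth 0 m (nth 0 t p) + count_mem (nth 0 t p) (take p t)).
have cellT p : p < size t -> in_shape (word_tab m w) (cell p).1 (cell p).2.
  move=> ps; rewrite in_shape_word_tab leq_addr addKn /= -/t.
  have := count_cat (pred1 (nth 0 t p)) (take p t) (drop p t).
  by rewrite cat_take_drop (drop_nth 0 ps) /= eqxx => ->; lia.
have entryT p : p < size t -> entry (word_tab m w) (cell p).1 (cell p).2 = p.+1.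
  by move=> ps; rewrite entry_word_tab ?cellT // addKn nth_letter_positions.
have ss : sorted (std_before (word_tab m w)) (mkseq cell (size t)).
  apply/(sortedP (0, 0)) => p; rewrite size_mkseq => ps.
  by rewrite !nth_mkseq ?(ltnW ps) // /std_before !entryT ?(ltnW ps) // ltnSn.
rewrite (companion_sorted _ ss).
  by rewrite -map_comp -[RHS]revK -/t; congr rev; apply: mkseq_nth.
apply: uniq_perm; last 1 first.
- move=> [i j]; rewrite mem_cells; apply/mapP/idP => [[p] | ij].
    by rewrite mem_iota /= => ps e; have := cellT p ps; rewrite -e.
  have := ij; rewrite in_shape_word_tab => /andP[mj jc].
  have [/= ps ti ck] := count_take_letter_position jc.
  exists (nth 0 (letter_positions i (rev w)) (j - nth 0 m i)).
    by rewrite mem_iota.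
  by rewrite /cell ti ck subnKC.
- by apply: sorted_uniq ss; [exact: std_before_trans | exact: std_before_irr].
exact: cells_uniq.
Qed.

Lemma insertion_order_wordP T u : is_part (inner T) ->
  insertion_order_word T u <-> yamanouchi (inner T) u.
Proof.
move=> pm; split=> [[U [sU <- <-]] | Y]; first exact: companion_yamanouchi.
exists (word_tab (inner T) u); split=> //.
  exact: word_tab_semistandard.
exact: companion_word_tab.
Qed.

Lemma semistandard_fillable T : semistandard T -> fillable T.
Proof.
move=> sT; have ms := inner_sub_outer sT.
have row_shape i k : k < size (row T i) -> in_shape T i (mu T i + k).
  by move=> ks; rewrite /in_shape leq_addr nth_outer // ltn_add2l.
have row_entry i k : entry T i (mu T i + k) = nth 0 (row T i) k.
  by rewrite /entry addKn.
apply/and3P; split=> //; last apply: zero_fill_sorted.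
  apply/(all_nthP [::]) => i _; apply/(all_nthP 0) => k ks.
  by rewrite -/(row T i) -row_entry; apply: entry_pos => //; apply: row_shape.
apply/(all_nthP [::]) => i _; apply/(sortedP 0) => k ks.
rewrite -/(row T i) -!row_entry addnS.
by apply: row_weak => //; rewrite -?addnS; apply: row_shape => //; apply: ltnW.
Qed.

Theorem theorem4p3 (T : skewtab) (u v : seq nat) :
  semistandard T ->
  insertion_order_word T u ->
  knuth_equiv u v ->
  insertion_order_word T v /\
  (exists T' : skewtab, phi_word u T = Some T' /\ phi_word v T = Some T').
Proof.
move=> sT; rewrite !insertion_order_wordP ?(inner_part sT) //.
exact: phi_word_knuth_equiv (semistandard_fillable sT).
Qed.
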